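(* Consider the following procedure on deterministic labeled graphs $G$ and $H$: choose any $p_0\in Q_G$ and set $p\gets p_0$, $X\gets Q_H$, $u\gets\epsilon$; while $|X|>0$, choose any $q\in X$ and look for a word $w$ with $w\in F_G(p)$ and $w\notin F_H(q)$; if such $w$ exists, set $p\gets p\cdot w$, $X\gets X\cdot w$, $u\gets uw$, otherwise return nil; when the loop ends, return $u$. Then, given deterministic labeled graphs $G$ and $H$ with $G$ irreducible, this procedure returns a word separating $G$ from $H$ if one exists, and returns nil otherwise.
   Context: A labeled graph $G$ has a finite vertex set $Q_G$, finite edge set, initial/terminal vertex maps on edges and an edge labeling into a finite alphabet (loops and multiple edges allowed; graphs need not be essential). Paths are finite sequences of consecutive edges; labels are concatenated edge labels; each vertex has an empty path labeled $\epsilon$. $F_G(q)$ is the set of labels of paths starting at $q$. $G$ is deterministic if no vertex has two outgoing edges with the same label; then $q\cdot w$ is the end vertex of the unique path from $q$ labeled $w$ (defined iff $w\in F_G(q)$) and $S\cdot w=\{q\cdot w: q\in S,\ w\in F_G(q)\}$ for $S\subseteq Q_G$. $G$ is irreducible if every vertex can reach every vertex by a path. A word $w$ separates $G$ from $H$ if $Q_G\cdot w\neq\varnothing$ and $Q_H\cdot w=\varnothing$. *)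

(* Defs.v *)
From mathcomp Require Import all_boot.
From Stdlib Require Import Relation_Operators.

Set Implicit Arguments.
Unset Strict Implicit.
Unset Printing Implicit Defensive.

Record lgraph (A : finType) := LGraph {
  vertex : finType;
  edge : finType;
  src : edge -> vertex;
  tgt : edge -> vertex;
  lab : edge -> A
}.

Section Graph.
Variables (A : finType) (G : lgraph A).
Implicit Types (p q : vertex G) (es : seq (edge G)) (w : seq A).

Fixpoint is_path q es : bool :=
  if es is e :: es' then (src e == q) && is_path (tgt e) es' else true.

Definition path_end q es : vertex G := last q (map (@tgt A G) es).

Definition path_label es : seq A := map (@lab A G) es.

Definition labeled_path q w es : bool := is_path q es && (path_label es == w).

(* A path labeled w has exactly size w edges, so quantifying over tuples
   rather than arbitrary sequences of edges loses nothing (see followerP). *)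
Definition follower q w : bool :=
  [exists es : (size w).-tuple (edge G), labeled_path q w es].

Lemma followerP q w : reflect (exists es, labeled_path q w es) (follower q w).
Proof.
apply: (iffP existsP) => [[es Hes]|[es Hes]]; first by exists es.
have sz : size es == size w.
  by case/andP: Hes => _ /eqP <-; rewrite size_map.
by exists (Tuple sz).
Qed.

Definition deterministic : Prop :=
  forall e1 e2 : edge G, src e1 = src e2 -> lab e1 = lab e2 -> e1 = e2.

Definition irreducible : Prop :=
  forall p q, exists2 es, is_path p es & path_end p es = q.

(* The partial action q . w, with None for undefined. The labeled path that is
   picked is the unique one when G is deterministic; for other graphs the value
   is an arbitrary choice and not meaningful. *)
Definition act q w : option (vertex G) :=
  if [pick es : (size w).-tuple (edge G) | labeled_path q w es] is Some es
  then Some (path_end q es) else None.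

Definition set_act (S : {set vertex G}) w : {set vertex G} :=
  [set q' | [exists q in S, follower q w && (act q w == Some q')]].

End Graph.

Definition separates (A : finType) (G H : lgraph A) (w : seq A) : Prop :=
  set_act [set: vertex G] w <> set0 /\ set_act [set: vertex H] w = set0.

Section Procedure.
Variables (A : finType) (G H : lgraph A).

(* Running p X u is the state at a test of the loop condition; Returned None
   stands for returning nil. *)
Inductive state :=
  | Running of vertex G & {set vertex H} & seq A
  | Returned of option (seq A).

(* One step is one test of the loop condition together with, if it holds, one
   execution of the loop body. The relation is nondeterministic in the choice
   of q in X and of the word w. *)
Inductive step : state -> state -> Prop :=
  | step_exit (p : vertex G) (X : {set vertex H}) (u : seq A) :
      #|X| = 0 -> step (Running p X u) (Returned (Some u))
  | step_extend (p p' : vertex G) (X : {set vertex H}) (u : seq A)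
      (q : vertex H) (w : seq A) :
      0 < #|X| -> q \in X -> follower p w -> ~~ follower q w ->
      act p w = Some p' ->
      step (Running p X u) (Running p' (set_act X w) (u ++ w))
  | step_nil (p : vertex G) (X : {set vertex H}) (u : seq A) (q : vertex H) :
      0 < #|X| -> q \in X ->
      (~ exists w, follower p w /\ ~~ follower q w) ->
      step (Running p X u) (Returned None).

Definition initial (p0 : vertex G) : state := Running p0 [set: vertex H] [::].

Definition reachable : state -> state -> Prop := clos_refl_trans state step.

Definition halted (s : state) : Prop := forall s', ~ step s s'.

Definition terminates (s : state) : Prop :=
  ~ exists r : nat -> state, r 0 = s /\ forall n, step (r n) (r n.+1).

Definition returns (s : state) (P : option (seq A) -> Prop) : Prop :=
  terminates s /\
  forall s', reachable s s' -> halted s' -> exists2 r, s' = Returned r & P r.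

End Procedure.

(* Main.v *)
(** Along every run, [p] is reached from [p0] by a path labeled [u], and [X]
    contains every vertex of [H] reached by a path labeled [u]; hence [u]
    separates as soon as [X] is empty. Each iteration shrinks [X], because [q]
    has no image under [w]. If some [w] separates [G] from [H], say through a
    vertex [s] of [G], then by irreducibility there is a path from [p] to [s],
    labeled [v] say, and [v ++ w] is a word that [p] follows and that no vertex
    of [H] follows, so the search never fails. *)
Require Import Defs.
From mathcomp Require Import all_boot.

Set Implicit Arguments.
Unset Strict Implicit.
Unset Printing Implicit Defensive.

Section LabeledPaths.
Variables (A : finType) (G : lgraph A).
Implicit Types (p q : vertex G) (es : seq (edge G)) (u w : seq A).
Implicit Types (S : {set vertex G}).

Lemma is_path_cat q es1 es2 :
  is_path q (es1 ++ es2) = is_path q es1 && is_path (path_end q es1) es2.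
Proof. by elim: es1 q => //= e es1 IHes q; rewrite IHes andbA. Qed.

Lemma path_end_cat q es1 es2 :
  path_end q (es1 ++ es2) = path_end (path_end q es1) es2.
Proof. by rewrite /path_end map_cat last_cat. Qed.

Lemma labeled_path_cat q u w es1 es2 :
  labeled_path q u es1 -> labeled_path (path_end q es1) w es2 ->
  labeled_path q (u ++ w) (es1 ++ es2).
Proof.
move=> /andP[p1 /eqP l1] /andP[p2 /eqP l2].
by rewrite /labeled_path is_path_cat p1 p2 /path_label map_cat -l1 -l2 eqxx.
Qed.

Lemma labeled_path_split q u w es :
  labeled_path q (u ++ w) es ->
  exists es1 es2, [/\ es = es1 ++ es2, labeled_path q u es1 &
                      labeled_path (path_end q es1) w es2].
Proof.
case/andP=> path_es /eqP lab_es.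
(* Each edge carries one letter, so the path is cut after [size u] edges. *)
exists (take (size u) es), (drop (size u) es).
move: path_es; rewrite -{1}(cat_take_drop (size u) es) is_path_cat.
case/andP=> path1 path2; rewrite cat_take_drop.
by rewrite /labeled_path path1 path2 /path_label map_take map_drop
  -/(path_label es) lab_es take_size_cat // drop_size_cat // !eqxx.
Qed.

Lemma labeled_path_uniq q w es1 es2 :
  deterministic G -> labeled_path q w es1 -> labeled_path q w es2 -> es1 = es2.
Proof.
move=> detG /andP[path1 /eqP <-] /andP[path2].
elim: es1 es2 q path1 path2 => [|e1 es1 IHes] [|e2 es2] //= q.
case/andP=> /eqP s1 path1 /andP[/eqP s2 path2] /eqP[l12 leq_es].
have e12 : e1 = e2 by apply: detG; rewrite ?s1 ?s2.
by rewrite -e12 in path2 *; rewrite (IHes es2 (tgt e1)) // leq_es.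
Qed.

Lemma act_Some q w q' :
  act q w = Some q' -> exists2 es, labeled_path q w es & path_end q es = q'.
Proof.
by rewrite /act; case: pickP => // es path_es [<-]; exists (tval es).
Qed.

Lemma follower_act q w : follower q w -> exists q', act q w = Some q'.
Proof.
rewrite /act => /existsP[es path_es].
by case: pickP => [es' _|/(_ es)]; [exists (path_end q es') | rewrite path_es].
Qed.

(** By uniqueness of labeled paths, the path picked inside [act] can only be [es]. *)
Lemma act_labeled_path q w es :
  deterministic G -> labeled_path q w es -> act q w = Some (path_end q es).
Proof.
move=> detG path_es.
have /follower_act[q' act_q] : follower q w by apply/followerP; exists es.
have [es' path_es' end_es'] := act_Some act_q.
by rewrite act_q (labeled_path_uniq detG path_es path_es') end_es'.
Qed.

Lemma set_act_labeled_path S q w es :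
  deterministic G -> q \in S -> labeled_path q w es ->
  path_end q es \in set_act S w.
Proof.
move=> detG qS path_es; rewrite inE; apply/exists_inP; exists q => //.
rewrite (act_labeled_path detG path_es) eqxx andbT.
by apply/followerP; exists es.
Qed.

Lemma set_act_eq0P S w :
  reflect (forall q, q \in S -> ~~ follower q w) (set_act S w == set0).
Proof.
apply: (iffP eqP) => [S0 q qS | notF].
  apply/negP => Fqw; have [q' act_q] := follower_act Fqw.
  have : q' \in set_act S w.
    by rewrite inE; apply/exists_inP; exists q; rewrite // Fqw act_q eqxx.
  by rewrite S0 inE.
apply/setP => q'; rewrite !inE; apply/exists_inP => -[q qS].
by rewrite (negPf (notF q qS)).
Qed.

(** The partial action maps [S :\ q] onto [set_act S w], since [q] contributes no image. *)
Lemma card_set_act_lt S q w :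
  q \in S -> ~~ follower q w -> #|set_act S w| < #|S|.
Proof.
move=> qS notF; rewrite [#|S|](cardsD1 q) qS add1n ltnS.
(* The default [x] only makes the action total; the preimages used below all have [act x w]
   defined. *)
apply: leq_trans (leq_imset_card (fun x => odflt x (act x w)) _).
apply/subset_leq_card/subsetP => q'; rewrite inE => /exists_inP[x xS].
case/andP=> Fx /eqP act_x; apply/imsetP; exists x; last by rewrite act_x.
by rewrite !inE xS andbT; apply: contraNneq notF => <-.
Qed.

End LabeledPaths.

Section Runs.
Variables (A : finType) (G H : lgraph A).
Implicit Types (s : state G H) (p : vertex G) (q : vertex H) (u w : seq A).

Lemma separatesP w :
  separates G H w <->
  (exists p, follower p w) /\ (forall q, ~~ follower q w).
Proof.
split=> [[/eqP GwN0 /eqP/set_act_eq0P Hw0] | [[p Fp] HF]]; split.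
- apply/existsP; apply: contraR GwN0 => /existsPn notF.
  by apply/set_act_eq0P => p _; apply: notF.
- by move=> q; apply: Hw0; rewrite inE.
- by move/eqP/set_act_eq0P/(_ p (in_setT p)); rewrite Fp.
- by apply/eqP/set_act_eq0P => q _; apply: HF.
Qed.

Lemma separates_extend p w :
  irreducible G -> separates G H w ->
  exists2 w', follower p w' & forall q, ~~ follower q w'.
Proof.
move=> irrG /separatesP[[s /followerP[es2 path2]] HF].
have [es1 path1 end1] := irrG p s.
exists (path_label es1 ++ w).
  apply/followerP; exists (es1 ++ es2); apply: labeled_path_cat.
    by rewrite /labeled_path path1 eqxx.
  by rewrite end1.
(* The final segment of such a path would be labeled [w] and start at some vertex of [H], but no
   vertex of [H] follows [w]. *)
move=> q; apply/followerP => -[es].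
case/labeled_path_split=> fs1 [fs2 [_ _ path_fs2]].
by move/followerP: (HF (path_end q fs1)); apply; exists fs2.
Qed.

(** The successor makes the exit step decrease the measure even though [X] is then empty. *)
Definition state_measure s := if s is Running _ X _ then #|X|.+1 else 0.

Lemma step_measure s s' : step s s' -> state_measure s' < state_measure s.
Proof.
by case=> //= p p' X u q w _ qX _ notF _; apply: (card_set_act_lt qX notF).
Qed.

Lemma always_terminates s : terminates s.
Proof.
case=> r [_ step_r].
(* Each step costs at least one unit, so the run cannot outlast its initial measure; one step beyond
   it gives the contradiction. *)
have bound n : state_measure (r n) + n <= state_measure (r 0).
  elim: n => [|n IHn]; first by rewrite addn0.
  by apply: leq_trans IHn; rewrite addnS -addSn leq_add2r; apply: step_measure.
have := bound (state_measure (r 0)).+1.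
by rewrite addnS ltnNge leq_addl.
Qed.

Lemma halted_returned s : halted s -> exists r, s = Returned G H r.
Proof.
case: s => [p X u | r] halt_s; last by exists r.
have [X0 | X_gt0] := posnP #|X|; first by case: (halt_s _ (step_exit p u X0)).
have /card_gt0P[q qX] := X_gt0.
(* There is no case split on whether a suitable word exists: such a word would enable [step_extend],
   which [halt_s] forbids, so the premise of [step_nil] holds and that step is possible. *)
case: (halt_s (Returned G H None)).
apply: (step_nil u X_gt0 qX) => -[w [Fp notFq]].
have [p' act_p] := follower_act Fp.
exact: halt_s (step_extend u X_gt0 qX Fp notFq act_p).
Qed.

(** For [X] one inclusion is enough, as only its emptiness is ever exploited. On returned states the
    invariant is the correctness claim itself. *)
Definition run_invariant (p0 : vertex G) s : Prop :=
  match s with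
  | Running p X u =>
      (exists2 es, labeled_path p0 u es & path_end p0 es = p) /\
      (forall q es, labeled_path q u es -> path_end q es \in X)
  | Returned (Some u) => separates G H u
  | Returned None => ~ exists w, separates G H w
  end.

Lemma run_invariant_initial p0 : run_invariant p0 (initial H p0).
Proof. by split=> [|q es _]; [exists [::] | rewrite inE]. Qed.

Lemma run_invariant_step p0 s s' :
  deterministic H -> irreducible G ->
  step s s' -> run_invariant p0 s -> run_invariant p0 s'.
Proof.
move=> detH irrG.
case=> [p X u X0 | p p' X u q w _ _ Fp _ act_p | p X u q _ _ notW] /=.
- case=> -[es path_es _] inX; apply/separatesP; split.
    by exists p0; apply/followerP; exists es.
  move=> q; apply/followerP => -[fs /inX].
  by rewrite (cards0_eq X0) inE.
- case=> -[es1 path1 end1] inX; split.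
    have [es2 path2 end2] := act_Some act_p.
    exists (es1 ++ es2); last by rewrite path_end_cat end1.
    by apply: labeled_path_cat; rewrite ?end1.
  (* The vertex reached after [u] lies in [X] by the invariant, and determinism of [H] makes the
     action send it to the end of [fs2]. *)
  move=> x es /labeled_path_split[fs1 [fs2 [-> pathf1 pathf2]]].
  by rewrite path_end_cat; apply: set_act_labeled_path => //; apply: inX.
- move=> _ [w sep_w]; apply: notW.
  by have [w' Fp HF] := separates_extend p irrG sep_w; exists w'.
Qed.

Lemma run_invariant_reachable p0 s s' :
  deterministic H -> irreducible G ->
  reachable s s' -> run_invariant p0 s -> run_invariant p0 s'.
Proof.
move=> detH irrG; elim=> [x y /run_invariant_step step_inv| //|].
  by apply: step_inv.
move=> x y z _ IHxy _ IHyz inv_x.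
exact/IHyz/IHxy.
Qed.

Lemma returns_invariant (p0 : vertex G) (P : option (seq A) -> Prop) :
  deterministic H -> irreducible G ->
  (forall r, run_invariant p0 (Returned G H r) -> P r) ->
  returns (initial H p0) P.
Proof.
move=> detH irrG invP; split; first exact: always_terminates.
move=> s' reach_s' /halted_returned[r s'E]; exists r => //; apply: invP.
rewrite -s'E; apply: run_invariant_reachable reach_s' _ => //.
exact: run_invariant_initial.
Qed.

End Runs.

Theorem theorem3p2 (A : finType) (G H : lgraph A)
    (detG : deterministic G) (detH : deterministic H) (irrG : irreducible G)
    (p0 : vertex G) :
  ((exists w, separates G H w) ->
     returns (initial H p0)
       (fun r => exists2 u, r = Some u & separates G H u)) /\
  ((~ exists w, separates G H w) ->
     returns (initial H p0) (fun r => r = None)).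
Proof.
(* The invariant at a returned state contradicts [None] when a separating word exists, and [Some u]
   when none does. *)
split=> sepGH; apply: returns_invariant => // -[u|] //= inv_u.
- by exists u.
- by case: sepGH; exists u.
Qed.
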